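(* Let $m,n$ be positive integers with $m\mid n$ and let $G=\mathbb{Z}_m\times\mathbb{Z}_n$. Let $d_1,\dots,d_k$ be all the (positive) divisors of $n$, and for $1\le i\le k$ let $n_i$ be the number of cyclic subgroups of $G$ of order $d_i$. Let $\langle(a_1,b_1)\rangle,\dots,\langle(a_l,b_l)\rangle$ be all the distinct cyclic subgroups of $G$. Then $$\psi(A(\mathscr{P}(G)),x)=(1+x)^{\alpha}\,\psi(Q,x),\qquad \alpha=\sum_{i=1}^{k}n_i(\phi(d_i)-1),$$ where $Q=(q_{ij})_{l\times l}$ is given by $$q_{ij}=\begin{cases}\phi(|\langle(a_j,b_j)\rangle|) & \text{if } i\ne j \text{ and } T_{\langle(a_i,b_i)\rangle}\sim T_{\langle(a_j,b_j)\rangle},\\ \phi(|\langle(a_i,b_i)\rangle|)-1 & \text{if } i=j,\\ 0&\text{otherwise.}\end{cases}$$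
   Context: For a finite group $G$, the power graph $\mathscr{P}(G)$ is the simple graph with vertex set $G$ in which two distinct vertices $x,y$ are adjacent iff $x=y^k$ or $y=x^k$ for some $k\in\mathbb{N}$. $A(H)$ is the adjacency matrix of a graph $H$; for a square matrix $N$, $\psi(N,x)=\det(xI-N)$. $\phi$ is Euler's totient function. For a cyclic subgroup $C$, $T_C$ denotes the set of all generators of $C$. For disjoint vertex sets $S_1,S_2$, $S_1\sim S_2$ means every vertex of $S_1$ is adjacent to every vertex of $S_2$ (in $\mathscr{P}(G)$). *)

(* Defs.v *)
From mathcomp Require Import all_boot all_order all_algebra.
From mathcomp Require Import all_fingroup all_solvable.

Set Implicit Arguments.
Unset Strict Implicit.
Unset Printing Implicit Defensive.

Import GRing.Theory.
Local Open Scope group_scope.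

(* The additive group of integers modulo p, for p > 0; unlike 'Z_p, this is
   the trivial group when p = 1. The finGroupType law is addition mod p. *)
Notation Zmodp p := 'I_p.-1.+1.

Section PowerGraph.

Variable gT : finGroupType.
Implicit Types (x y : gT) (e : rel gT) (A B C : {set gT}).

(* Since y ^+ 0 = y ^+ #[y], letting k range over the positive naturals only
   would give the same relation. *)
Definition power_adj x y : Prop :=
  x <> y /\ exists k : nat, x = y ^+ k \/ y = x ^+ k.

Lemma power_adj_dec x y : decidable (power_adj x y).
Proof.
apply: (@decP _ [&& x != y & (x \in <[y]>) || (y \in <[x]>)]).
apply: (iffP andP) => [[/eqP xy /orP h] | [/eqP xy [k h]]]; split=> //.
  by case: h => /cycleP[k ->]; exists k; [left | right].
by apply/orP; case: h => ->; rewrite mem_cycle; [left | right].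
Qed.

Definition power_graph : rel gT := fun x y => power_adj_dec x y.

Lemma power_graphP x y : reflect (power_adj x y) (power_graph x y).
Proof. exact: sumboolP. Qed.

Definition gens C : {set gT} := [set x | generator C x].

Definition fully_adjacent e A B : bool :=
  [forall x in A, forall y in B, e x y].

Definition num_cyclic_subgroups (d : nat) : nat :=
  #|[set H : {group gT} | cyclic H & #|H| == d]|.

End PowerGraph.

Definition adjacency_matrix (T : finType) (e : rel T) : 'M[int]_#|T| :=
  \matrix_(i, j) (e (enum_val i) (enum_val j))%:R%R.

Definition quotient_matrix (gT : finGroupType) (l : nat) (c : 'I_l -> gT) :
    'M[int]_l :=
  \matrix_(i, j)
    (if i == j then (totient #|<[c i]>|)%:R - 1
     else if fully_adjacent (@power_graph gT) (gens <[c i]>) (gens <[c j]>)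
     then (totient #|<[c j]>|)%:R
     else 0)%R.

(* Main.v *)
Require Import Defs.
From mathcomp Require Import all_boot all_order all_algebra.
From mathcomp Require Import all_fingroup all_solvable.

Set Implicit Arguments.
Unset Strict Implicit.
Unset Printing Implicit Defensive.

Import GRing.Theory.
Local Open Scope ring_scope.

(* Whether distinct x and y are adjacent depends only on <x> and <y>, and the
   generators of one cyclic subgroup form a clique. Hence A + I = U V and
   Q + I = V U, where U is the incidence matrix of elements versus cyclic
   subgroups and V records adjacency-or-equality of a cyclic subgroup and an
   element. Since det(yI - UV) and det(yI - VU) agree up to a power of y,
   taking y = x + 1 leaves the exponent |G| - l, which is alpha because G is
   the disjoint union of its l classes of generators. *)

(* Weinstein-Aronszajn identity *)
Lemma det_scalar_sub_mulmxC (R : comNzRingType) (n l : nat) (y : R)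
    (U : 'M[R]_(n, l)) (V : 'M[R]_(l, n)) :
  y ^+ l * \det (y%:M - U *m V) = y ^+ n * \det (y%:M - V *m U).
Proof.
(* Both sides come from [\det M]: clearing [V] by column operations leaves [y - UV], while clearing
   [U] leaves [y - VU] but scales the last [l] columns by [y], whence the factor [y ^+ l]. *)
pose M : 'M_(n + l) := block_mx y%:M U V 1%:M.
have detM : \det M = \det (y%:M - U *m V).
  have /(congr1 determinant) : M *m block_mx 1%:M 0 (- V) 1%:M
      = block_mx (y%:M - U *m V) U 0 1%:M.
    by rewrite mulmx_block !mulmx1 !mulmx0 mul1mx mulmxN addrN !add0r.
  by rewrite det_mulmx det_lblock det_ublock !det1 !mulr1.
have /(congr1 determinant) : M *m block_mx 1%:M (- U) 0 y%:M
    = block_mx y%:M 0 V (y%:M - V *m U).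
  rewrite mulmx_block !mulmx1 !mulmx0 !addr0 !mulmxN mul1mx.
  by rewrite mul_mx_scalar mul_scalar_mx addNr [- _ + _]addrC.
by rewrite det_mulmx det_ublock det_lblock detM det1 mul1r !det_scalar mulrC.
Qed.

(** Subtracting the identity shifts the variable, so this is the preceding identity over polynomials
    at [y = 1 + 'X]. Powers on both sides avoid comparing [n] with [l]. *)
Lemma char_poly_mulmx_sub1C (R : comNzRingType) (n l : nat)
    (U : 'M[R]_(n, l)) (V : 'M[R]_(l, n)) :
  (1 + 'X) ^+ l * char_poly (U *m V - 1%:M)
    = (1 + 'X) ^+ n * char_poly (V *m U - 1%:M).
Proof.
have shift k (A : 'M[R]_k) :
    char_poly (A - 1%:M) = \det ((1 + 'X)%:M - map_mx polyC A).
  rewrite /char_poly /char_poly_mx map_mxB map_scalar_mx opprB addrA.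
  by rewrite [('X)%:M + _]addrC -raddfD.
by rewrite !shift !map_mxM det_scalar_sub_mulmxC.
Qed.

Section CycleComparable.

Variable gT : finGroupType.

(** The reflexive closure of adjacency; the diagonal it adds is the identity in A + I and Q + I. *)
Definition cycle_comparable (x y : gT) : bool :=
  (x \in <[y]>%g) || (y \in <[x]>%g).

Lemma power_graphE (x y : gT) :
  power_graph x y = (x != y) && cycle_comparable x y.
Proof.
apply/power_graphP/andP => [[/eqP xy [k h]] | [/eqP xy /orP h]]; split=> //.
  by apply/orP; case: h => ->; rewrite mem_cycle; [left | right].
by case: h => /cycleP[k ->]; exists k; [left | right].
Qed.

Lemma eq_cycle_comparable (x x' y y' : gT) :
    <[x]>%g = <[x']>%g -> <[y]>%g = <[y']>%g ->
  cycle_comparable x y = cycle_comparable x' y'.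
Proof.
by rewrite /cycle_comparable -!cycle_subG /= => -> ->.
Qed.

(** Comparability sees only the generated subgroups, so one pair of generators decides for all.
    Distinct subgroups share no generator, so irreflexivity of adjacency does not interfere. *)
Lemma fully_adjacent_gens (x y : gT) : <[x]>%g != <[y]>%g ->
  fully_adjacent (@power_graph gT) (gens <[x]>%g) (gens <[y]>%g)
    = cycle_comparable x y.
Proof.
move=> neq_xy; apply/forall_inP/idP => [adj | cmp u].
  have gens_self (z : gT) : z \in gens <[z]>%g by rewrite inE /generator.
  have /forall_inP/(_ y (gens_self y)) := adj x (gens_self x).
  by rewrite power_graphE => /andP[].
rewrite inE => /eqP eu; apply/forall_inP => v.
rewrite inE => /eqP ev.
rewrite power_graphE -(eq_cycle_comparable eu ev) cmp andbT.
by apply: contraNneq neq_xy => uv; rewrite eu ev uv.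
Qed.

End CycleComparable.

Section PowerGraphQuotient.

Variables (gT : finGroupType) (l : nat) (c : 'I_l -> gT).
Hypothesis cycle_c_inj : injective (fun i => <[c i]>%g).
Hypothesis cycle_c_surj : forall x : gT, exists i, <[x]>%g == <[c i]>%g.

Let cls (x : gT) : 'I_l := xchoose (cycle_c_surj x).

Let cycle_cls x : <[c (cls x)]>%g = <[x]>%g.
Proof. exact/esym/eqP/(xchooseP (cycle_c_surj x)). Qed.

Let eq_cls x i : (cls x == i) = (<[c i]> == <[x]>)%g.
Proof.
by rewrite -(cycle_cls x) (inj_eq cycle_c_inj) eq_sym.
Qed.

Let sumr_cls i : (\sum_x (cls x == i))%N = totient #|<[c i]>%g|.
Proof.
rewrite totient_gen -sum1_card [RHS]big_mkcond /=; apply: eq_bigr => x _.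
by rewrite eq_cls inE /generator; case: (_ == _).
Qed.

Let sum_totient : (\sum_i totient #|<[c i]>%g|)%N = #|gT|.
Proof.
under eq_bigr => i _ do rewrite -sumr_cls.
rewrite exchange_big -sum1_card /=; apply: eq_bigr => x _.
by rewrite (bigD1 (cls x)) //= eqxx big1 // => i /negbTE; rewrite eq_sym => ->.
Qed.

(** Each class of generators contributes its size as [(totient d - 1) + 1], the ones adding up to
    [l]. As all orders divide [n], each subgroup is counted at exactly one divisor. *)
Lemma card_eq_sum_num_cyclic_subgroups (n : nat) :
    (0 < n)%N -> (forall x : gT, #[x]%g %| n)%N ->
  (\sum_(d <- divisors n) num_cyclic_subgroups gT d * (totient d - 1) + l)%N
    = #|gT|.
Proof.
move=> n_gt0 order_dvd.
have num_d d : num_cyclic_subgroups gT d = (\sum_i (#[c i]%g == d))%N.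
  rewrite /num_cyclic_subgroups -big_mkcond sum1_card.
  have injG : injective (fun i => <[c i]>%G).
    by move=> i j /(congr1 val)/cycle_c_inj.
  rewrite -(card_imset _ injG); apply: eq_card => H; rewrite inE.
  apply/andP/imsetP => [[/cyclicP[x defH] /eqP oH] | [i oi ->]]; last first.
    by rewrite cycle_cyclic.
  exists (cls x); first by rewrite unfold_in /order cycle_cls -defH; apply/eqP.
  by apply: val_inj; rewrite /= cycle_cls.
under eq_bigr => d _ do rewrite num_d big_distrl.
rewrite exchange_big /= -sum_totient -[X in (_ + X)%N]card_ord -sum1_card.
rewrite -big_split /=; apply: eq_bigr => i _.
rewrite (bigD1_seq #[c i]%g) ?divisors_uniq //=; last by rewrite -dvdn_divisors.
rewrite eqxx mul1n big1 => [|d /negbTE]; last by rewrite eq_sym => ->.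
by rewrite addn0 subnK // totient_gt0.
Qed.

Lemma char_poly_power_graph (n : nat) :
    (0 < n)%N -> (forall x : gT, #[x]%g %| n)%N ->
  char_poly (adjacency_matrix (@power_graph gT))
    = (1 + 'X)
        ^+ (\sum_(d <- divisors n)
              num_cyclic_subgroups gT d * (totient d - 1))%N
      * char_poly (quotient_matrix c).
Proof.
move=> n_gt0 order_dvd.
pose U : 'M[int]_(#|gT|, l) := \matrix_(i, j) (cls (enum_val i) == j)%:R.
pose V : 'M[int]_(l, #|gT|) :=
  \matrix_(i, j) (cycle_comparable (c i) (enum_val j))%:R.
have -> : adjacency_matrix (@power_graph gT) = U *m V - 1%:M.
  (* Row [i] of [U] has a single 1, in the column of its class. *)
  apply/matrixP => i j; rewrite !mxE (bigD1 (cls (enum_val i))) //= big1.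
    rewrite !mxE eqxx mul1r addr0 power_graphE (inj_eq enum_val_inj).
    rewrite (eq_cycle_comparable (cycle_cls _) (erefl _)).
    by case: eqP => [->|_]; rewrite ?subr0 // /cycle_comparable cycle_id subrr.
  by move=> k /negbTE; rewrite !mxE eq_sym => ->; rewrite mul0r.
have -> : quotient_matrix c = V *m U - 1%:M.
  apply/matrixP => i j; rewrite !mxE.
  (* Column [j] of [U] selects the generators of [<[c j]>], on which comparability with [c i] is
     constant. *)
  have -> : \sum_k V i k * U k j
      = (cycle_comparable (c i) (c j))%:R * (totient #|<[c j]>%g|)%:R.
    rewrite -sumr_cls natr_sum mulr_sumr.
    rewrite [RHS](reindex_onto enum_val enum_rank) /=; last by move=> x _; exact: enum_rankK.
    apply: eq_big => [k|k _]; first by rewrite enum_valK eqxx.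
    rewrite !mxE eq_cls; case: eqP => [e|]; last by rewrite !mulr0.
    by rewrite (eq_cycle_comparable (erefl _) e).
  have [<-|neq_ij] := eqVneq i j.
    by rewrite /cycle_comparable cycle_id mul1r.
  rewrite fully_adjacent_gens ?(inj_eq cycle_c_inj) // subr0.
  by case: cycle_comparable; rewrite ?mul1r ?mul0r.
(* Integer polynomials form a domain, so the surplus factor [(1 + 'X) ^+ l] can be cancelled. *)
have X1_neq0 : (1 + 'X : {poly int}) ^+ l != 0.
  by rewrite expf_neq0 // -size_poly_gt0 addrC -polyC1 size_XaddC.
apply: (mulfI X1_neq0); rewrite char_poly_mulmx_sub1C mulrA -exprD addnC.
by rewrite card_eq_sum_num_cyclic_subgroups.
Qed.

End PowerGraphQuotient.

Lemma order_Zmodp (p : nat) (x : Zmodp p) : (0 < p)%N -> (#[x]%g %| p)%N.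
Proof.
case: p x => // p x _.
by have := order_dvdG (in_setT x); rewrite cardsT card_ord.
Qed.

Lemma expg_pair (gT hT : finGroupType) (x : gT) (y : hT) k :
  ((x, y) ^+ k = (x ^+ k, y ^+ k))%g.
Proof.
by elim: k => // k IHk; rewrite !expgS IHk.
Qed.

Theorem theorem3p1 (m n : nat) (hm : (0 < m)%N) (hn : (0 < n)%N)
    (hmn : (m %| n)%N) (l : nat) (a : 'I_l -> Zmodp m) (b : 'I_l -> Zmodp n)
    (hdistinct : forall i j : 'I_l,
       <[(a i, b i)]>%g = <[(a j, b j)]>%g -> i = j)
    (hall : forall H : {group Zmodp m * Zmodp n},
       cyclic H -> exists i : 'I_l, H :=: <[(a i, b i)]>%g) :
  let G : finGroupType := (Zmodp m * Zmodp n)%type in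
  let alpha : nat :=
    (\sum_(d <- divisors n) num_cyclic_subgroups G d * (totient d - 1))%N in
  let Q : 'M[int]_l := quotient_matrix (fun i => (a i, b i) : G) in
  char_poly (adjacency_matrix (@power_graph G))
    = (1 + 'X) ^+ alpha * char_poly Q.
Proof.
move=> G alpha Q; apply: char_poly_power_graph => //.
- by move=> x; have [i /eqP] := hall _ (cycle_cyclic x); exists i.
(* Since [m] divides [n], the exponent [n] kills both coordinates. *)
- case=> x y; rewrite order_dvdn expg_pair.
  have /eqP-> : (x ^+ n == 1)%g.
    by rewrite -order_dvdn (dvdn_trans (order_Zmodp x hm)).
  by have /eqP-> : (y ^+ n == 1)%g by rewrite -order_dvdn order_Zmodp.
Qed.
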